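(* Let $n_+,n_-\ge 1$ be integers, $n=n_++n_-$, and let $B$ be the indefinite Kirchhoff Laplacian on the star graph $G$ with $n$ unit edges (defined in the context). Let $\eta_1$ be the first (i.e. smallest) positive eigenvalue of $B$. Then the ratio between $n_+$ and $n_-$ is given by $$\frac{n_+}{n_-}=-\coth(\sqrt{\eta_1})\,\tan(\sqrt{\eta_1}).$$
   Context: $G$ is a star graph with $n=n_++n_-$ edges, each identified with $(0,1)$, all joined at the central vertex $0$. $L^2(G)=\bigoplus_{j=1}^n L^2((0,1))$. The operator $B$ in $L^2(G)$ has domain $$\mathcal D(B)=\Big\{f=(f_1,\dots,f_n): f_j\in H^2((0,1)),\ f_j(1)=0\ \text{for all } j,\ f_1(0)=\dots=f_n(0),\ \sum_{j=1}^n f_j'(0)=0\Big\}$$ and acts as $(Bf)_j=-f_j''$ for $1\le j\le n_+$ and $(Bf)_j=f_j''$ for $n_++1\le j\le n$. *)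

(* Defs.v *)
From HB Require Import structures.
From mathcomp Require Import all_boot all_order all_algebra.
From mathcomp Require Import complex.
From mathcomp Require Import all_classical all_reals all_analysis.

Set Implicit Arguments.
Unset Strict Implicit.
Unset Printing Implicit Defensive.
Import Order.TTheory GRing.Theory Num.Theory.
Import numFieldNormedType.Exports.

Local Open Scope classical_set_scope.
Local Open Scope ring_scope.
Local Open Scope complex_scope.

Section SobolevInterval.
Context {R : realType}.

Definition unit_itv : set R := `]0, 1[%classic.

(* Elements of L^2((0,1)) are represented by functions R -> R[i]; their values
   outside (0,1) are irrelevant and equality is almost everywhere on (0,1). *)
Definition L2_eq (u v : R -> R[i]) : Prop :=
  u = v %[ae (@lebesgue_measure R) in unit_itv].

Definition L2 (u : R -> R[i]) : Prop :=
  [/\ measurable_fun unit_itv (fun x => complex.Re (u x)),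
      measurable_fun unit_itv (fun x => complex.Im (u x)) &
      (@lebesgue_measure R).-integrable unit_itv
        (fun x => (complex.Re (u x) ^+ 2 + complex.Im (u x) ^+ 2)%:E)].

(* phi belongs to C_c^oo((0,1)), extended by 0 to the real line. *)
Definition test_function (phi : R -> R) : Prop :=
  [/\ forall (k : nat) (x : R), derivable (derive1n k phi) x 1,
      compact (closure [set x | phi x != 0]) &
      closure [set x | phi x != 0] `<=` unit_itv].

(* The complex number \int_0^1 u phi, for real-valued phi. *)
Definition pairing (u : R -> R[i]) (phi : R -> R) : R[i] :=
  (\int[@lebesgue_measure R]_(x in unit_itv) (complex.Re (u x) * phi x)) +i*
  (\int[@lebesgue_measure R]_(x in unit_itv) (complex.Im (u x) * phi x)).

(* v is in L^2((0,1)) and is the weak (distributional) k-th derivative of u. *)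
Definition weak_deriv (k : nat) (u v : R -> R[i]) : Prop :=
  L2 v /\
  forall phi, test_function phi ->
    pairing u (derive1n k phi) = (-1) ^+ k * pairing v phi.

(* H^m((0,1)) *)
Definition Sobolev (m : nat) (u : R -> R[i]) : Prop :=
  L2 u /\ forall k, (k <= m)%N -> exists v, weak_deriv k u v.

(* The continuous representative of u on [0,1] takes the value c at a; only
   used for a = 0 and a = 1. *)
Definition trace_at (a : R) (u : R -> R[i]) (c : R[i]) : Prop :=
  exists v : R -> R[i],
    [/\ {within `[0, 1], continuous (fun x => complex.Re (v x))},
        {within `[0, 1], continuous (fun x => complex.Im (v x))},
        L2_eq u v & v a = c].

(* u'(a) = c, for u in H^2((0,1)). *)
Definition deriv_trace_at (a : R) (u : R -> R[i]) (c : R[i]) : Prop :=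
  exists2 v, weak_deriv 1 u v & trace_at a v c.

End SobolevInterval.

Section StarGraph.
Context {R : realType} (np nn : nat).

(* A function on the star graph: one component per edge. The edges j < np are
   the positive ones; on each edge, the coordinate 0 is the central vertex. *)
Definition graph_fun := 'I_(np + nn) -> R -> R[i].

Definition graph_L2_eq (f g : graph_fun) : Prop := forall j, L2_eq (f j) (g j).

Definition dom_B (f : graph_fun) : Prop :=
  [/\ forall j, Sobolev 2 (f j),
      forall j, trace_at 1 (f j) 0,
      exists c, forall j, trace_at 0 (f j) c &
      exists2 d : 'I_(np + nn) -> R[i],
        forall j, deriv_trace_at 0 (f j) (d j) & \sum_j d j = 0].

(* The graph of B: f is in the domain of B and B f = g in L^2(G). *)
Definition B_graph (f g : graph_fun) : Prop :=
  dom_B f /\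
  exists2 f2 : graph_fun, forall j, weak_deriv 2 (f j) (f2 j) &
    graph_L2_eq g (fun j x => if (j < np)%N then - f2 j x else f2 j x).

Definition eigenvalue_B (lambda : R[i]) : Prop :=
  exists f : graph_fun,
    ~ graph_L2_eq f (fun _ _ => 0) /\ B_graph f (fun j x => lambda * f j x).

Definition first_positive_eigenvalue_B (eta : R) : Prop :=
  [/\ 0 < eta, eigenvalue_B eta%:C &
      forall mu : R, 0 < mu -> eigenvalue_B mu%:C -> eta <= mu].

End StarGraph.

Definition coth {R : realType} (x : R) : R :=
  (expR x + expR (- x)) / (expR x - expR (- x)).

(* Main.v *)
(* On an edge, an eigenfunction for the eigenvalue eta = k^2 is a weak solution
   of y'' = -k^2 y (positive edges) or y'' = k^2 y (negative edges), hence equal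
   to c C + d S, where C, S are cos(k x), sin(k x)/k or cosh(k x), sinh(k x)/k
   and c, d are its value and derivative at the vertex. If sin k <> 0, the
   Dirichlet condition at 1 gives d = - c C(1)/S(1); then c <> 0, and the
   Kirchhoff condition becomes n_+ cot k + n_- coth k = 0, which is the claim.
   By the intermediate value theorem this secular equation has a root in
   ]pi/2, pi[, so that the first positive eigenvalue is smaller than pi^2 and
   sin k > 0 holds for it (the eigenvalue pi^2, for which c = 0 is possible, is
   not the first one).

   No regularity theory is needed for weak solutions: if F has the continuous
   weak derivative g and g has the weak derivative s F, then
   g(x) S(t - x) + F(x) C(t - x) has weak derivative 0, so it is constant by the
   lemma of du Bois-Reymond; compare its values at x = 0 and x = t. *)

Require Import Defs.
From mathcomp Require Import all_boot all_order all_algebra.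
From mathcomp Require Import all_classical all_reals all_analysis.
From mathcomp Require Import complex ring lra measurable_realfun.
Set Implicit Arguments.
Unset Strict Implicit.
Unset Printing Implicit Defensive.
Import Order.TTheory GRing.Theory Num.Theory.
Import numFieldNormedType.Exports.
Local Open Scope classical_set_scope.
Local Open Scope ring_scope.
Local Notation "f ^` ()" := (derive1 f) : ring_scope.

(** * Smooth functions on the real line and algebras stable under derivation *)

Section SmoothFunctions.
Context {R : realType}.
Implicit Types (x : R) (f g : R -> R) (B : (R -> R) -> Prop).

Definition smooth f := forall k x, derivable (derive1n k f) x 1.

Lemma derivable1_is_derive f x : derivable f x 1 -> is_derive x 1 f (f^`() x).
Proof. by move=> df; rewrite derive1E; exact: derivableP. Qed.

Lemma is_derive1_eq f (df : R -> R) :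
  (forall x : R, is_derive x 1 f (df x)) -> f^`() = df.
Proof. by move=> H; apply/funext => x; rewrite derive1E; exact: derive_val. Qed.

Lemma smooth_derive1 f : smooth f -> smooth f^`().
Proof. by move=> sf k x; rewrite -derive1Sn; exact: sf. Qed.

Lemma smooth_continuous f : smooth f -> continuous f.
Proof.
move=> sf x; apply: differentiable_continuous.
by apply/derivable1_diffP; exact: (sf 0%N).
Qed.

(** Coinduction principle: smoothness follows from one derivation step inside an invariant class, so
    no formula for iterated derivatives of products or compositions is ever written. *)
Lemma smooth_coind (P : (R -> R) -> Prop) f :
  (forall g, P g -> (forall x, derivable g x 1) /\ P g^`()) -> P f -> smooth f.
Proof.
move=> HP Pf k x; have /HP[//] : P (derive1n k f).
by elim: k => [//|k /HP[]]; rewrite derive1nS.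
Qed.

Inductive alg B : (R -> R) -> Prop :=
| alg_base f : B f -> alg B f
| alg_cst c : alg B (fun=> c)
| alg_add f g : alg B f -> alg B g -> alg B (fun x => f x + g x)
| alg_mul f g : alg B f -> alg B g -> alg B (fun x => f x * g x).

(* The algebra generated by B is then closed under derivation. *)
Lemma smooth_alg B :
  (forall f, B f -> (forall x, derivable f x 1) /\ alg B f^`()) ->
  forall f, alg B f -> smooth f.
Proof.
move=> HB f; apply: (@smooth_coind (alg B)) => {}f.
elim=> [{}f /HB//|c|{}f g _ [df Af'] _ [dg Ag']|{}f g Af [df Af'] Ag [dg Ag']].
- split=> [x|]; first exact: derivable_cst.
  have -> : (fun=> c : R)^`() = (fun=> 0) :> (R -> R).
    by apply/funext => x; rewrite derive1_cst.
  exact: alg_cst.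
- split=> [x|]; first exact: (@derivableD _ _ _ f g).
  rewrite (_ : _^`() = fun x => f^`() x + g^`() x); first exact: alg_add.
  by apply/funext => x; rewrite !derive1E -(@deriveD _ _ _ f g).
- split=> [x|]; first exact: (@derivableM _ _ f g).
  rewrite (_ : _^`() = fun x => f x * g^`() x + g x * f^`() x).
    by apply: alg_add; exact: alg_mul.
  by apply/funext => x; rewrite !derive1E (@deriveM _ _ f g).
Qed.

Lemma smoothM f g : smooth f -> smooth g -> smooth (fun x => f x * g x).
Proof.
move=> sf sg; apply: (smooth_alg (B := smooth)) => [h sh|].
  by split=> [x|]; [exact: (sh 0%N)|apply: alg_base; exact: smooth_derive1].
by apply: alg_mul; exact: alg_base.
Qed.

Lemma smooth_cst c : smooth (fun _ : R => c).
Proof. by apply: (smooth_alg (B := fun=> False)) => //; exact: alg_cst. Qed.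

Lemma smoothD f g : smooth f -> smooth g -> smooth (fun x => f x + g x).
Proof.
move=> sf sg; apply: (smooth_alg (B := smooth)) => [h sh|].
  by split=> [x|]; [exact: (sh 0%N)|apply: alg_base; exact: smooth_derive1].
by apply: alg_add; exact: alg_base.
Qed.

End SmoothFunctions.

(** * Flat functions and smooth bumps with compact support *)

Section BumpFunctions.
Context {R : realType}.

(** The classical function [exp(-1/x) / x^n], extended by 0. The index [n] is there because the
    derivative of [flat n] is a combination of [flat n.+2] and [flat n.+1]. *)
Definition flat (n : nat) (x : R) : R :=
  if x <= 0 then 0 else (x^-1) ^+ n * expR (- x^-1).

Lemma flat_ge0 n x : 0 <= flat n x.
Proof.
rewrite /flat; case: (leP x 0) => [|x0]; first by rewrite lexx.
by rewrite mulr_ge0 ?expR_ge0// exprn_ge0// invr_ge0 ltW.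
Qed.

(** With [y = 1/x], the exponential series gives [y^(n+2) / (n+2)! <= exp y]. The quadratic bound
    makes every [flat n] differentiable at 0 with derivative 0. *)
Lemma flat_le n x : flat n x <= (n.+2)`!%:R * x ^+ 2.
Proof.
rewrite /flat; case: (leP x 0) => x0; first by rewrite mulr_ge0// sqr_ge0.
have y0 : 0 < x^-1 by rewrite invr_gt0.
rewrite expRN ler_pdivrMr ?expR_gt0//.
have fact0 : 0 < (n.+2)`!%:R :> R by rewrite ltr0n fact_gt0.
have : (x^-1) ^+ n.+2 / (n.+2)`!%:R <= expR x^-1.
  by apply: le_trans (expR_ge1Dxn n.+1 (ltW y0)); rewrite lerDr.
rewrite ler_pdivrMr// => h.
have -> : (x^-1) ^+ n = x ^+ 2 * (x^-1) ^+ n.+2.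
  by rewrite -(addn2 n) exprD mulrCA -exprMn mulfV ?gt_eqF// expr1n mulr1.
rewrite (_ : _ * expR _ = x ^+ 2 * (expR x^-1 * (n.+2)`!%:R)); last by ring.
by rewrite ler_wpM2l ?sqr_ge0.
Qed.

Lemma is_derive_flat n (x : R) :
  is_derive x 1 (flat n) (flat n.+2 x - n%:R * flat n.+1 x).
Proof.
have [x0|x0|->] := ltgtP x 0.
- have -> : flat n.+2 x - n%:R * flat n.+1 x = 0.
    by rewrite /flat ltW// mulr0 subr0.
  apply: (@near_eq_is_derive _ _ _ (cst 0)) => //.
  near=> y; rewrite /flat ifT//.
  by apply: ltW; near: y; exact: lt_nbhsl.
- pose E y := (y^-1) ^+ n * expR (- y^-1) : R.
  suff dE : is_derive x 1 E (flat n.+2 x - n%:R * flat n.+1 x).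
    apply: (@near_eq_is_derive _ _ _ E) => //.
    near=> y; rewrite /flat leNgt ifF//; apply/negbF.
    by near: y; exact: lt_nbhsr.
  have dV : is_derive x 1 (fun y : R => y^-1) (- x ^- 2 *: 1).
    by apply: is_deriveV; rewrite gt_eqF.
  have dX : is_derive x^-1 1 (fun y : R => y ^+ n) (n%:R * x^-1 ^+ n.-1).
    have := derivableP (@exprn_derivable R n x^-1 1).
    by rewrite exp_derive [_ *: 1]mulr1.
  have dXV := is_derive1_comp dX dV.
  have dEV := @is_derive1_comp R expR (- (fun y : R => y^-1)) x _ _
    (is_derive_expR (- x^-1)) (is_deriveN dV).
  have := is_deriveM dXV dEV; rewrite /comp => dE.
  apply: (@is_derive_eq _ _ _ _ _ _ _ _ dE).
  change (x^-1 ^+ n * (expR (- x^-1) * - (- x ^- 2 * 1)) +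
    expR (- x^-1) * (n%:R * x^-1 ^+ n.-1 * (- x ^- 2 * 1)) =
    flat n.+2 x - n%:R * flat n.+1 x).
  rewrite /flat leNgt x0/= -exprVn; move: (x^-1) (expR _) => y e.
  (* The power rule produces the truncated exponent [n.-1]; for [n = 0] its factor [n%:R]
     vanishes. *)
  by case: n {dX dXV dE E} => [|n]; rewrite !exprS/=; ring.
(* At 0 the difference quotient is bounded by [(n+2)! |h|], by [flat_le]. *)
- suff H : (fun h : R => h^-1 *: (flat n (h *: 1 + 0) - flat n 0)) @ 0^' --> (0 : R).
    have -> : flat n.+2 0 - n%:R * flat n.+1 0 = 0.
      by rewrite /flat lexx mulr0 subr0.
    by apply: DeriveDef; [apply/cvg_ex; exists 0|apply/cvg_lim].
  apply/cvgr0Pnorm_le => e e0.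
  near=> h.
  have h0 : h != 0 by near: h; exact: nbhs_dnbhs_neq.
  have -> : flat n 0 = 0 by rewrite /flat lexx.
  rewrite subr0 addr0 -[h *: 1]/(h * 1) mulr1 normrZ normfV ler_pdivrMl ?normr_gt0//.
  rewrite (ger0_norm (flat_ge0 _ _)).
  rewrite (le_trans (flat_le _ _))// -real_normK ?num_real// expr2 mulrCA ler_wpM2l//.
  rewrite -ler_pdivlMl ?ltr0n ?fact_gt0//.
  near: h; apply: nbhs_dnbhs.
  exists ((n.+2)`!%:R^-1 * e) => /=; first by rewrite mulr_gt0// invr_gt0 ltr0n fact_gt0.
  by move=> y /=; rewrite sub0r normrN => /ltW.
Unshelve. all: by end_near. Qed.

Definition bump (a b x : R) := flat 0 (x - a) * flat 0 (b - x).

Lemma smooth_bump a b : smooth (bump a b).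
Proof.
(* The affine substitution is built into the generators: deriving one only changes the index of
   [flat] and brings out the constant [c]. *)
pose B (f : R -> R) := exists n c d, f = fun x => flat n (c * x + d).
apply: (smooth_alg (B := B)) => [_ [n [c [d ->]]]|].
  have daff (x : R) : is_derive x 1 (fun x => c * x + d) (c : R).
    by apply: is_derive_eq; rewrite addr0 [_ *: _]mulr1.
  have dg x := @is_derive1_comp _ (flat n) (fun x => c * x + d) x _ _
    (is_derive_flat n (c * x + d)) (daff x).
  split=> [x|]; first by case: (dg x).
  rewrite (is_derive1_eq dg).
  have -> : (fun x => (flat n.+2 (c * x + d) - n%:R * flat n.+1 (c * x + d)) * c) =
    (fun x => (flat n.+2 (c * x + d) + (- n%:R) * flat n.+1 (c * x + d)) * c).
    by apply/funext => x; rewrite mulNr.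
  apply: (@alg_mul _ _ (fun x => _ + _)); last exact: alg_cst.
  apply: alg_add; first by apply: alg_base; exists n.+2, c, d.
  apply: alg_mul; first exact: alg_cst.
  by apply: alg_base; exists n.+1, c, d.
apply: alg_mul; apply: alg_base.
  by exists 0%N, 1, (- a); apply/funext => x; rewrite mul1r.
by exists 0%N, (- 1), b; apply/funext => x; rewrite mulN1r addrC.
Qed.

Lemma bump_ge0 a b x : 0 <= bump a b x.
Proof. by rewrite mulr_ge0// flat_ge0. Qed.

Lemma bump_gt0 a b x : a < x < b -> 0 < bump a b x.
Proof.
move=> /andP[ax xb]; rewrite /bump /flat !expr0 !mul1r.
by rewrite !leNgt !subr_gt0 ax xb/= mulr_gt0// expR_gt0.
Qed.

Lemma bump_eq0 a b x : ~~ (a < x < b) -> bump a b x = 0.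
Proof.
rewrite negb_and -!leNgt /bump /flat !subr_le0 => /orP[]->; first by rewrite mul0r.
by rewrite mulr0.
Qed.

End BumpFunctions.

(** * Continuous functions on [0, 1]: integrals and equality almost everywhere *)

Section UnitInterval.
Context {R : realType}.
Notation mu := (@lebesgue_measure R).
Notation I := (@unit_itv R).

Lemma measurable_unit_itv : measurable I.
Proof. exact: measurable_itv. Qed.

Lemma unit_itv_sub : I `<=` `[0, 1].
Proof. by move=> x /=; rewrite !in_itv/= => /andP[/ltW -> /ltW ->]. Qed.

Lemma continuous_integrable (f : R -> R) :
  {within `[0, 1], continuous f} -> mu.-integrable I (EFin \o f).
Proof.
move=> cf.
have fI : mu.-integrable `[0, 1] (EFin \o f).
  by apply: continuous_compact_integrable => //; exact: segment_compact.
apply: integrableS fI => //; first exact: measurable_unit_itv.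
exact: unit_itv_sub.
Qed.

Lemma within_continuousM (A : set R) (f g : R -> R) :
  {within A, continuous f} -> {within A, continuous g} ->
  {within A, continuous (fun x => f x * g x)}.
Proof. by move=> cf cg x; apply: cvgM; [exact: cf|exact: cg]. Qed.

Lemma within_continuous_fun_add (A : set R) (f g : R -> R) :
  {within A, continuous f} -> {within A, continuous g} ->
  {within A, continuous (fun x => f x + g x)}.
Proof. by move=> cf cg x; apply: cvgD; [exact: cf|exact: cg]. Qed.

Lemma continuous_eq_closed (f g : R -> R) :
  {within `[0, 1], continuous f} -> {within `[0, 1], continuous g} ->
  {in I, f =1 g} -> forall x, 0 <= x <= 1 -> f x = g x.
Proof.
move=> /(continuous_within_itvP _ ltr01)[_ f0 f1].
move=> /(continuous_within_itvP _ ltr01)[_ g0 g1] fg x /andP[].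
rewrite le_eqVlt => /predU1P[<- _|x0].
  apply: (cvg_unique _ f0) => //; apply: cvg_trans g0.
  apply: near_eq_cvg; near=> y; rewrite fg// inE /I/= in_itv/=; apply/andP; split.
    by near: y; exact: nbhs_right_gt.
  by near: y; exact: nbhs_right_lt.
rewrite le_eqVlt => /predU1P[->|x1].
  apply: (cvg_unique _ f1) => //; apply: cvg_trans g1.
  apply: near_eq_cvg; near=> y; rewrite fg// inE /I/= in_itv/=; apply/andP; split.
    by near: y; exact: nbhs_left_gt.
  by near: y; exact: nbhs_left_lt.
by apply: fg; rewrite inE /I/= in_itv/= x0 x1.
Unshelve. all: by end_near. Qed.

(** A difference at an interior point would persist on an open interval, whose measure is positive;
    the endpoints follow by continuity. Thus traces do not depend on the chosen continuous
    representative. *)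
Lemma ae_eq_continuous (f g : R -> R) :
  {within `[0, 1], continuous f} -> {within `[0, 1], continuous g} ->
  f = g %[ae mu in I] -> forall x, 0 <= x <= 1 -> f x = g x.
Proof.
move=> cf cg fg; apply: continuous_eq_closed => // x /set_mem xI.
apply: contrapT => /eqP fgx.
have [cf1 cg1] : {for x, continuous f} /\ {for x, continuous g}.
  by split; apply: (within_continuous_continuous ltr01).
have : \forall y \near x, I y /\ f y - g y != 0.
  near=> y; split.
    by near: y; apply: open_nbhs_nbhs; split => //; exact: interval_open.
  near: y; apply: (@cvgr_neq0 _ _ _ _ _ (fun y => f y - g y) (f x - g x)).
    exact: cvgB.
  by rewrite subr_eq0.
move=> [e /= e0 He].
have : mu.-negligible `]x - e, x + e[%classic.
  apply: negligibleS fg => y xy /= H.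
  have [|Iy] := He y; first by have := xy; rewrite -ball_itv.
  by rewrite subr_eq0 => /eqP; apply; exact: H.
move=> N; have : mu `]x - e, x + e[%classic = 0%E.
  by apply/negligibleP => //; exact: measurable_itv.
rewrite lebesgue_measure_itv/= lte_fin ifT; last by lra.
by rewrite -EFinB => /eqP; rewrite eqe => /eqP; lra.
Unshelve. all: by end_near. Qed.

Lemma Rintegral_unit_itv (f : R -> R) :
  {within `[0, 1], continuous f} ->
  \int[mu]_(x in I) f x = \int[mu]_(x in `[0, 1]) f x.
Proof.
move=> cf.
have fI : mu.-integrable `[0, 1] (EFin \o f).
  by apply: continuous_compact_integrable => //; exact: segment_compact.
rewrite /unit_itv Rintegral_itv_bndo_bndc.
  rewrite Rintegral_itv_obnd_cbnd//; apply: integrableS fI => //.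
  by apply: subset_itvr; rewrite bnd_simp.
by apply: integrableS fI => //; exact: unit_itv_sub.
Qed.

Lemma Rintegral_unitD (f g : R -> R) :
  {within `[0, 1], continuous f} -> {within `[0, 1], continuous g} ->
  \int[mu]_(x in I) (f x + g x) = \int[mu]_(x in I) f x + \int[mu]_(x in I) g x.
Proof.
move=> /continuous_integrable fI /continuous_integrable gI.
by rewrite RintegralD//; exact: measurable_unit_itv.
Qed.

End UnitInterval.

(** * Test functions and the lemma of du Bois-Reymond *)

Section TestFunctions.
Context {R : realType}.
Implicit Types (f phi : R -> R).
Notation mu := (@lebesgue_measure R).
Notation I := (@unit_itv R).

Lemma test_function_intro f (l r : R) : 0 < l -> r < 1 -> smooth f ->
  (forall x, ~~ (l <= x <= r) -> f x = 0) -> test_function f.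
Proof.
move=> l0 r1 sf f0.
have sub : closure [set x | f x != 0] `<=` `[l, r].
  rewrite [X in _ `<=` X](closure_id _).1; last exact: itv_closed.
  apply: closureS => x /=; rewrite in_itv/= => fx.
  by apply: contraNT fx => /f0 ->.
split=> //.
  apply: subclosed_compact sub; first exact: closed_closure.
  exact: segment_compact.
move=> x /sub /=; rewrite !in_itv/= => /andP[lx xr].
by rewrite /unit_itv/= in_itv/= (lt_le_trans l0 lx) (le_lt_trans xr r1).
Qed.

Lemma test_function_smooth phi : test_function phi -> smooth phi.
Proof. by case. Qed.

Lemma test_function_continuous phi :
  test_function phi -> {within `[0, 1], continuous phi}.
Proof.
by move=> /test_function_smooth/smooth_continuous; exact: continuous_subspaceT.
Qed.

Lemma test_function0 phi x : test_function phi -> ~~ (0 < x < 1) -> phi x = 0.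
Proof.
move=> [_ _ sub]; apply: contraNeq => phix.
have /sub : closure [set x | phi x != 0] x by apply: subset_closure.
by rewrite /unit_itv/= in_itv.
Qed.

Lemma test_function_derive1 phi : test_function phi -> test_function phi^`().
Proof.
move=> [sphi cphi sub].
have subd : closure [set x | phi^`() x != 0] `<=` closure [set x | phi x != 0].
  rewrite [X in _ `<=` X](closure_id _).1; last exact: closed_closure.
  apply: closureS => x /=; apply: contraPP => nx.
  apply/negP; rewrite negbK derive1E.
  rewrite (@near_eq_derive _ _ _ phi (cst 0)); first by rewrite derive_cst.
  have : open_nbhs x (~` closure [set x | phi x != 0]).
    by split => //; apply: closed_openC; exact: closed_closure.
  move=> /open_nbhs_nbhs; apply: filterS => y /= ny.
  by apply/eqP; apply: contrapT => /negP py; apply: ny; exact: subset_closure.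
split; first exact: smooth_derive1.
- by apply: subclosed_compact subd => //; exact: closed_closure.
- exact: subset_trans sub.
Qed.

Lemma test_functionM f phi :
  smooth f -> test_function phi -> test_function (fun x => f x * phi x).
Proof.
move=> sf [sphi cphi sub].
have subd : closure [set x | f x * phi x != 0] `<=` closure [set x | phi x != 0].
  by apply: closureS => x /=; apply: contra => /eqP ->; rewrite mulr0.
split; first exact: smoothM.
- by apply: subclosed_compact subd => //; exact: closed_closure.
- exact: subset_trans sub.
Qed.

(** The primitive starting at 0 vanishes to the left of [l] because [rho] does, and to the right of
    [r] because the total integral is 0; so it has compact support in ]0, 1[. *)
Lemma test_function_primitive (rho : R -> R) (l r : R) :
  0 < l -> r < 1 -> smooth rho ->
  (forall x, ~~ (l <= x <= r) -> rho x = 0) ->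
  \int[mu]_(x in I) rho x = 0 ->
  exists2 phi, test_function phi & phi^`() = rho.
Proof.
move=> l0 r1 srho rho0 int0.
pose phi (x : R) := \int[mu]_(t in `[0, x]) rho t.
have philt x : x < l -> phi x = 0.
  move=> xl; rewrite /phi (@eq_Rintegral _ _ _ _ _ (cst 0)).
    by rewrite Rintegral_cst// mul0r.
  move=> y; rewrite inE/= in_itv/= => /andP[_ yx].
  by rewrite rho0// negb_and -ltNge (le_lt_trans yx xl).
have phigt x : r < x -> phi x = 0.
  move=> rx; rewrite -int0 /phi Rintegral_mkcond [RHS]Rintegral_mkcond.
  congr (Rintegral _ _ _); apply/funext => y; rewrite !patchE.
  case: ifPn => yx; case: ifPn => yI //.
  - rewrite rho0//; apply: contra yI => /andP[ly yr].
    by rewrite inE /unit_itv/= in_itv/= (lt_le_trans l0 ly) (le_lt_trans yr r1).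
  - rewrite rho0//; apply: contra yx => /andP[ly yr].
    by rewrite inE /= in_itv/= (le_trans (ltW l0) ly) (le_trans yr (ltW rx)).
have dphi (x : R) : is_derive x 1 phi (rho x).
  (* The fundamental theorem of calculus, on [[0, x + 1]], requires [0 < x]; to the left of [l] the
     primitive is locally constant instead. *)
  have [xl|lx] := ltP x l.
    rewrite rho0; last by rewrite negb_and -ltNge xl.
    apply: (@near_eq_is_derive _ _ _ (cst 0)) => //.
    by near=> y; rewrite philt//; near: y; exact: lt_nbhsl.
  have [] := @continuous_FTC1_closed _ rho 0 x (x + 1).
  - by rewrite ltrDl.
  - apply: continuous_compact_integrable; first exact: segment_compact.
    by apply: continuous_subspaceT; exact: smooth_continuous.
  - exact: lt_le_trans lx.
  - exact: smooth_continuous.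
  by move=> d <-; exact: derivable1_is_derive.
have phiE : phi^`() = rho by exact: is_derive1_eq.
exists phi; last exact: phiE.
apply: (test_function_intro l0 r1).
  move=> [|k] x; first by case: (dphi x).
  by rewrite derive1Sn phiE; exact: srho.
by move=> x; rewrite negb_and -!ltNge => /orP[/philt|/phigt].
Unshelve. all: by end_near. Qed.

(* A primitive of a bump of zero integral would be a monotone test function. *)
Lemma Rintegral_bump_gt0 (a b : R) : 0 < a -> a < b -> b < 1 ->
  0 < \int[mu]_(x in I) bump a b x.
Proof.
move=> a0 ab b1; rewrite lt_neqAle Rintegral_ge0 ?andbT; last first.
  by move=> x _; exact: bump_ge0.
apply/eqP => /esym int0.
have [x|phi tphi phiE] := test_function_primitive a0 b1 (@smooth_bump R a b) _ int0.
  by move=> h; rewrite bump_eq0//; apply: contra h => /andP[/ltW -> /ltW ->].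
have phi_le (x y : R) : 0 <= x -> x <= y -> y <= 1 -> phi x <= phi y.
  apply: ger0_derive1_ndecr => [z _|z _|].
  - by have [sphi _ _] := tphi; exact: (sphi 0%N).
  - by rewrite phiE bump_ge0.
  - exact: test_function_continuous.
have phi0 (x : R) : phi x = 0.
  have [/andP[x0 x1]|x01] := boolP (0 < x < 1); last exact: test_function0 x01.
  apply/eqP; rewrite eq_le.
  have := phi_le x 1 (ltW x0) (ltW x1) (lexx _).
  rewrite (@test_function0 _ 1 tphi) ?ltxx ?andbF// => -> /=.
  have := phi_le 0 x (lexx _) (ltW x0) (ltW x1).
  by rewrite (@test_function0 _ 0 tphi) ?ltxx.
have : bump a b ((a + b) / 2) = 0.
  rewrite -phiE (_ : phi = cst 0) ?derive1_cst//.
  exact/funext.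
by move/eqP; rewrite gt_eqF// bump_gt0//; apply/andP; split; lra.
Qed.

(** A bump with small enough support around [a] acts on [W] like a multiple of a Dirac mass: there
    [W] stays within [e] of [W a]. *)
Lemma bump_average (W : R -> R) (a e : R) :
  {within `[0, 1], continuous W} -> 0 < a < 1 -> 0 < e ->
  exists l r : R, [/\ 0 < l, l < r, r < 1,
    (W a - e) * \int[mu]_(x in I) bump l r x <= \int[mu]_(x in I) (W x * bump l r x) &
    \int[mu]_(x in I) (W x * bump l r x) <= (W a + e) * \int[mu]_(x in I) bump l r x].
Proof.
move=> cW a01 e0; have mI := @measurable_unit_itv R.
have /cvgrPdist_le/(_ e e0) : W x @[x --> a] --> W a.
  by apply: (within_continuous_continuous ltr01) => //; rewrite in_itv.
move=> [d /= d0 Hd].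
have [a0 a1] := andP a01.
(* The first two bounds keep the support [[a - m, a + m]] inside ]0, 1[, the third keeps it where
   [W] is within [e] of [W a]. *)
pose m := Num.min (Num.min (a / 2) ((1 - a) / 2)) (d / 2).
have m0 : 0 < m by rewrite !lt_min; apply/andP; split; [apply/andP; split|]; lra.
have m1 : m <= a / 2 by rewrite !ge_min lexx.
have m2 : m <= (1 - a) / 2 by rewrite !ge_min lexx orbT.
have m3 : m <= d / 2 by rewrite !ge_min lexx orbT.
exists (a - m), (a + m).
have cb : {within `[0, 1], continuous (bump (a - m) (a + m))}.
  by apply: continuous_subspaceT; apply: smooth_continuous; exact: smooth_bump.
have close x : a - m < x < a + m -> W a - e <= W x <= W a + e.
  move=> /andP[ax xa].
  have := Hd x; rewrite /ball_/= => H.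
  have : `|W a - W x| <= e by apply: H; rewrite ltr_norml; apply/andP; split; lra.
  by rewrite ler_norml => /andP[? ?]; apply/andP; split; lra.
have icst c : mu.-integrable I (EFin \o (fun x => c * bump (a - m) (a + m) x)).
  apply: continuous_integrable; apply: within_continuousM => //.
  by apply: continuous_subspaceT => ?; exact: cvg_cst.
have iW : mu.-integrable I (EFin \o (fun x => W x * bump (a - m) (a + m) x)).
  by apply: continuous_integrable; exact: within_continuousM.
have ib := continuous_integrable cb.
split; [lra|lra|lra| |].
- rewrite -RintegralZl//; apply: le_Rintegral => // x _.
  have [/close/andP[? ?]|h] := boolP (a - m < x < a + m).
    by rewrite ler_wpM2r// bump_ge0.
  by rewrite bump_eq0// !mulr0.
- rewrite -RintegralZl//; apply: le_Rintegral => // x _.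
  have [/close/andP[? ?]|h] := boolP (a - m < x < a + m).
    by rewrite ler_wpM2r// bump_ge0.
  by rewrite bump_eq0// !mulr0.
Qed.

(* W is tested against a primitive of a combination of two bumps with zero
   integral, concentrated near a and near b respectively. *)
Lemma du_bois_reymond (W : R -> R) : {within `[0, 1], continuous W} ->
  (forall phi, test_function phi -> \int[mu]_(x in I) (W x * phi^`() x) = 0) ->
  forall x, 0 <= x <= 1 -> W x = W 0.
Proof.
move=> cW HW.
have mI := @measurable_unit_itv R.
(* An inequality for arbitrary pairs suffices, since [a] and [b] can be exchanged. The slack [e] is
   shared equally between the two bumps. *)
have le_interior a b : 0 < a < 1 -> 0 < b < 1 -> W a <= W b.
  move=> a01 b01; apply/ler_addgt0Pr => e e0.
  have e20 : 0 < e / 2 by rewrite divr_gt0.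
  have [l [r [l0 lr r1 h1 _]]] := bump_average cW a01 e20.
  have [l' [r' [l'0 l'r' r'1 _ h2]]] := bump_average cW b01 e20.
  set Ia := \int[mu]_(x in I) bump l r x in h1.
  set Ib := \int[mu]_(x in I) bump l' r' x in h2.
  have Ia0 : 0 < Ia by exact: Rintegral_bump_gt0.
  have Ib0 : 0 < Ib by exact: Rintegral_bump_gt0.
  have cbump u v : {within `[0, 1], continuous (@bump R u v)}.
    by apply: continuous_subspaceT; apply: smooth_continuous; exact: smooth_bump.
  have ccst (c : R) : {within `[0, 1], continuous (fun _ : R => c)}.
    by apply: continuous_subspaceT => ?; exact: cvg_cst.
  pose rho x := Ib * bump l r x + (- Ia) * bump l' r' x.
  have srho : smooth rho.
    by apply: smoothD; (apply: smoothM; [exact: smooth_cst|exact: smooth_bump]).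
  have int0 : \int[mu]_(x in I) rho x = 0.
    rewrite RintegralD//; last 2 first.
    - by apply: continuous_integrable; exact: within_continuousM.
    - by apply: continuous_integrable; exact: within_continuousM.
    rewrite !RintegralZl//; try exact: continuous_integrable.
    by rewrite -/Ia -/Ib; ring.
  have [||x|phi tphi phiE] := @test_function_primitive rho
      (Num.min l l') (Num.max r r') _ _ srho _ int0.
  - by rewrite lt_min l0.
  - by rewrite gt_max r1.
  - move=> h; rewrite /rho !bump_eq0 ?mulr0 ?addr0//.
      by apply: contra h => /andP[/ltW u /ltW v]; rewrite ge_min le_max u v !orbT.
    by apply: contra h => /andP[/ltW u /ltW v]; rewrite ge_min le_max u v.
  have := HW _ tphi; rewrite phiE.
  have -> : \int[mu]_(x in I) (W x * rho x) =
      \int[mu]_(x in I) (Ib * (W x * bump l r x) + - Ia * (W x * bump l' r' x)).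
    by apply: eq_Rintegral => x _; rewrite /rho; ring.
  rewrite RintegralD//; last 2 first.
  - by apply: continuous_integrable; do 2 apply: within_continuousM => //.
  - by apply: continuous_integrable; do 2 apply: within_continuousM => //.
  rewrite !RintegralZl//; try by apply: continuous_integrable; exact: within_continuousM.
  move: h1 h2; set Ja := Rintegral _ _ _; set Jb := Rintegral _ _ _ => h1 h2 h3.
  (* Here [h3] says [Ib * Ja = Ia * Jb], whence [(W a - e/2) Ia Ib <= Ja Ib = Jb Ia <= (W b + e/2)
     Ia Ib]. *)
  rewrite -(ler_pM2r (mulr_gt0 Ia0 Ib0)).
  have := ler_wpM2r (ltW Ib0) h1; have := ler_wpM2r (ltW Ia0) h2; nra.
move=> x x01.
pose c := cst (W (1 / 2)) : R -> R.
have E : {in I, W =1 c}.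
  move=> y /set_mem; rewrite /unit_itv/= in_itv/= => y01.
  have h : 0 < (1 / 2 : R) < 1 by apply/andP; split; lra.
  by apply/eqP; rewrite eq_le !le_interior.
have cc : {within `[0, 1], continuous c}.
  by apply: continuous_subspaceT => ?; exact: cvg_cst.
rewrite (continuous_eq_closed cW cc E x01).
by rewrite (continuous_eq_closed cW cc E) ?lexx ?ler01.
Qed.

End TestFunctions.

(** * Transfer of almost everywhere statements and of integrals *)

Section AlmostEverywhere.
Context {R : realType}.
Notation mu := (@lebesgue_measure R).
Notation I := (@unit_itv R).

Lemma ae_unit_imp (P Q : R -> Prop) : (forall x, I x -> P x -> Q x) ->
  {ae mu, forall x, I x -> P x} -> {ae mu, forall x, I x -> Q x}.
Proof.
move=> PQ; apply: filterS; first exact: (ae_filter_ringOfSetsType mu).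
by move=> x H Ix; exact/PQ/H.
Qed.

Lemma ae_unit_imp2 (P Q S : R -> Prop) :
  (forall x, I x -> P x -> Q x -> S x) -> {ae mu, forall x, I x -> P x} ->
  {ae mu, forall x, I x -> Q x} -> {ae mu, forall x, I x -> S x}.
Proof.
move=> PQS; apply: filterS2; first exact: (ae_filter_ringOfSetsType mu).
by move=> x HP HQ Ix; exact: PQS (HP Ix) (HQ Ix).
Qed.

Lemma measurable_continuous (f : R -> R) :
  {within `[0, 1], continuous f} -> measurable_fun I f.
Proof. by move=> /continuous_integrable/integrableP[/measurable_EFinP]. Qed.

Lemma ae_eq_Rintegral (u v phi : R -> R) :
  measurable_fun I u -> measurable_fun I v ->
  {within `[0, 1], continuous phi} -> u = v %[ae mu in I] ->
  \int[mu]_(x in I) (u x * phi x) = \int[mu]_(x in I) (v x * phi x).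
Proof.
move=> mu_ mv cphi uv; have mI := @measurable_unit_itv R.
have mphi := measurable_continuous cphi.
congr fine; apply: ae_eq_integral => //.
- by apply/measurable_EFinP; exact: measurable_funM.
- by apply/measurable_EFinP; exact: measurable_funM.
- by apply: ae_unit_imp uv => x _ /= ->.
Qed.

End AlmostEverywhere.

(** * Weak solutions of [y'' = s y] on an edge *)

Section WeakOde.
Context {R : realType}.
Notation mu := (@lebesgue_measure R).
Notation I := (@unit_itv R).
(** An abstract fundamental system of [y'' = s y], normalised at 0 by [S0] and [C0] below; this
    treats trigonometric and hyperbolic edges at once. *)
Variables (s : R) (S C : R -> R).
Hypothesis dS : forall x : R, is_derive x 1 S (C x).
Hypothesis dC : forall x : R, is_derive x 1 C (s * S x).

Lemma is_derive_reflect (f df : R -> R) (t : R) :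
  (forall x : R, is_derive x 1 f (df x)) ->
  forall x : R, is_derive x 1 (fun x => f (t - x)) (- df (t - x)).
Proof.
move=> dfE x.
have d1 : is_derive x 1 (fun x : R => t - x) (- 1 : R).
  by have := is_deriveB (is_derive_cst t x 1) (is_derive_id x 1); rewrite sub0r.
have := @is_derive1_comp _ f (fun x => t - x) x _ _ (dfE (t - x)) d1.
by rewrite mulrN1.
Qed.

Lemma derive1_reflectS (t : R) :
  (fun x => S (t - x))^`() = fun x => - C (t - x).
Proof. exact: is_derive1_eq (is_derive_reflect t dS). Qed.

Lemma derive1_reflectC (t : R) :
  (fun x => C (t - x))^`() = fun x => - (s * S (t - x)).
Proof. exact: is_derive1_eq (is_derive_reflect t dC). Qed.

Lemma smooth_reflect (t : R) :
  smooth (fun x => S (t - x)) /\ smooth (fun x => C (t - x)).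
Proof.
pose B (f : R -> R) := f = (fun x => S (t - x)) \/ f = (fun x => C (t - x)).
have BS : alg B (fun x => S (t - x)) by apply: alg_base; left.
have BC : alg B (fun x => C (t - x)) by apply: alg_base; right.
suff HB f : B f -> (forall x, derivable f x 1) /\ alg B f^`().
  by split; exact: (smooth_alg HB).
move=> [->|->]; split=> [x|].
- by case: (is_derive_reflect t dS x).
- rewrite derive1_reflectS (_ : (fun x => _) = fun x => (- 1) * C (t - x)).
    by apply: alg_mul => //; exact: alg_cst.
  by apply/funext => x; rewrite mulN1r.
- by case: (is_derive_reflect t dC x).
- rewrite derive1_reflectC (_ : (fun x => _) = fun x => (- s) * S (t - x)).
    by apply: alg_mul => //; exact: alg_cst.
  by apply/funext => x; rewrite mulNr.
Qed.

Hypothesis S0 : S 0 = 0.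
Hypothesis C0 : C 0 = 1.

Lemma weak_ode_solution (F g : R -> R) :
  {within `[0, 1], continuous F} -> {within `[0, 1], continuous g} ->
  (forall phi, test_function phi ->
    \int[mu]_(x in I) (F x * phi^`() x) = - \int[mu]_(x in I) (g x * phi x)) ->
  (forall phi, test_function phi ->
    \int[mu]_(x in I) (g x * phi^`() x) = - \int[mu]_(x in I) (s * F x * phi x)) ->
  forall t, 0 <= t <= 1 -> F t = F 0 * C t + g 0 * S t.
Proof.
move=> cF cg HF Hg t t01.
have [sS sC] := smooth_reflect t.
have cont (f : R -> R) : smooth f -> {within `[0, 1], continuous f}.
  by move=> /smooth_continuous; exact: continuous_subspaceT.
have cS := cont _ sS; have cC := cont _ sC.
pose W x := g x * S (t - x) + F x * C (t - x).
have cW : {within `[0, 1], continuous W}.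
  exact: within_continuous_fun_add (within_continuousM cg cS) (within_continuousM cF cC).
have ccst (c : R) : {within `[0, 1], continuous (fun _ : R => c)}.
  by apply: continuous_subspaceT => ?; exact: cvg_cst.
have /(_ _ t01) : forall x, 0 <= x <= 1 -> W x = W 0.
  apply: du_bois_reymond => // phi tphi.
  have tS := test_functionM sS tphi.
  have tC := test_functionM sC tphi.
  have dphi x : derivable phi x 1 by have [/(_ 0%N x)] := tphi.
  have dSphi x : (fun x => S (t - x) * phi x)^`() x =
      S (t - x) * phi^`() x - C (t - x) * phi x.
    rewrite derive1E (@deriveM _ _ (fun x => S (t - x)) phi x 1 (sS 0%N x) (dphi x)).
    by rewrite -!derive1E derive1_reflectS /GRing.scale/=; ring.
  have dCphi x : (fun x => C (t - x) * phi x)^`() x =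
      C (t - x) * phi^`() x - s * S (t - x) * phi x.
    rewrite derive1E (@deriveM _ _ (fun x => C (t - x)) phi x 1 (sC 0%N x) (dphi x)).
    by rewrite -!derive1E derive1_reflectC /GRing.scale/=; ring.
  have cphi := test_function_continuous tphi.
  have ctS := test_function_continuous (test_function_derive1 tS).
  have ctC := test_function_continuous (test_function_derive1 tC).
  (* The product rule absorbs [phi'] into derivatives of test functions. The cancellation is
     crosswise: [HF] tested on [C(t - x) phi] removes the [g] term, [Hg] tested on [S(t - x) phi]
     the [s F] term. *)
  transitivity (\int[mu]_(x in I)
    ((g x * (fun x => S (t - x) * phi x)^`() x + g x * (C (t - x) * phi x)) +
     (F x * (fun x => C (t - x) * phi x)^`() x + s * F x * (S (t - x) * phi x)))).
    by apply: eq_Rintegral => x _; rewrite dSphi dCphi /W; ring.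
  have c1 : {within `[0, 1],
      continuous (fun x => g x * (fun x => S (t - x) * phi x)^`() x)}.
    exact: within_continuousM cg ctS.
  have c2 : {within `[0, 1], continuous (fun x => g x * (C (t - x) * phi x))}.
    exact: within_continuousM cg (within_continuousM cC cphi).
  have c3 : {within `[0, 1],
      continuous (fun x => F x * (fun x => C (t - x) * phi x)^`() x)}.
    exact: within_continuousM cF ctC.
  have c4 : {within `[0, 1], continuous (fun x => s * F x * (S (t - x) * phi x))}.
    exact: within_continuousM (within_continuousM (ccst s) cF) (within_continuousM cS cphi).
  rewrite (Rintegral_unitD (within_continuous_fun_add c1 c2)
    (within_continuous_fun_add c3 c4)).
  rewrite (Rintegral_unitD c1 c2) (Rintegral_unitD c3 c4).
  by rewrite (HF _ tC) (Hg _ tS); ring.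
by rewrite /W subrr S0 C0 mulr0 add0r mulr1 subr0 addrC.
Qed.

(** Here [F0] and [F1] are the continuous representatives of [f] coming from the traces at 0 and 1,
    and [G] is that of its weak derivative [v]. [F0] and [F1] agree on [0, 1], so the solution
    formula for [F0] can be read at 1. *)
Lemma edge_solution (f v f2 F0 F1 G : R -> R) :
  measurable_fun I f -> measurable_fun I v -> measurable_fun I f2 ->
  {within `[0, 1], continuous F0} -> {within `[0, 1], continuous F1} ->
  {within `[0, 1], continuous G} ->
  f = F0 %[ae mu in I] -> f = F1 %[ae mu in I] -> v = G %[ae mu in I] ->
  (forall phi, test_function phi ->
    \int[mu]_(x in I) (f x * phi^`() x) = - \int[mu]_(x in I) (v x * phi x)) ->
  (forall phi, test_function phi ->
    \int[mu]_(x in I) (f x * phi^`()^`() x) = \int[mu]_(x in I) (f2 x * phi x)) ->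
  f2 = (fun x => s * f x) %[ae mu in I] ->
  F1 1 = F0 0 * C 1 + G 0 * S 1 /\
  (F0 0 = 0 -> G 0 = 0 -> f = cst 0 %[ae mu in I]).
Proof.
move=> mf mv mf2 cF0 cF1 cG fF0 fF1 vG Hf Hf2 f2E.
have H : forall t, 0 <= t <= 1 -> F0 t = F0 0 * C t + G 0 * S t.
  apply: weak_ode_solution => // phi tphi.
  - rewrite -(@ae_eq_Rintegral R f F0)//; last 2 first.
    + exact: measurable_continuous.
    + exact/test_function_continuous/test_function_derive1.
    rewrite -(@ae_eq_Rintegral R v G)//; [exact: Hf|exact: measurable_continuous|].
    exact: test_function_continuous.
  - rewrite -(@ae_eq_Rintegral R v G)//; last 2 first.
    + exact: measurable_continuous.
    + exact/test_function_continuous/test_function_derive1.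
    (* Testing the first-order relation on [phi'] and then using the second-order one shows that
       [f2] is the weak derivative of [v]. *)
    apply: oppr_inj; rewrite opprK -(Hf _ (test_function_derive1 tphi)) Hf2//.
    apply: ae_eq_Rintegral => //.
    + by apply: measurable_funM => //; exact: measurable_continuous.
    + exact: test_function_continuous.
    + by apply: ae_unit_imp2 f2E fF0 => x _ -> ->.
split.
  rewrite -(H 1) ?ler01 ?lexx//; apply: (ae_eq_continuous cF1 cF0).
    by apply: ae_unit_imp2 fF1 fF0 => x _ <- <-.
  by rewrite ler01 lexx.
move=> F00 G0; apply: ae_unit_imp fF0 => x Ix ->.
by rewrite H ?F00 ?G0 ?mul0r ?addr0//; move: Ix => /unit_itv_sub /=; rewrite in_itv.
Qed.

End WeakOde.

(** * Classical derivatives are weak derivatives *)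

Section SmoothWeakDerivative.
Context {R : realType}.
Notation mu := (@lebesgue_measure R).
Notation I := (@unit_itv R).

Lemma smooth_LRcontinuous (f : R -> R) : smooth f -> derivable_oo_LRcontinuous f 0 1.
Proof.
move=> sf; have cf := smooth_continuous sf; split=> [x _||].
- exact: (sf 0%N).
- by apply: cvg_at_right_filter; exact: cf.
- by apply: cvg_at_left_filter; exact: cf.
Qed.

Lemma smooth_weak_deriv (u phi : R -> R) : smooth u -> test_function phi ->
  \int[mu]_(x in I) (u x * phi^`() x) = - \int[mu]_(x in I) (u^`() x * phi x).
Proof.
move=> su tphi.
have sphi := test_function_smooth tphi.
have cont (f : R -> R) : smooth f -> {within `[0, 1], continuous f}.
  by move=> /smooth_continuous; exact: continuous_subspaceT.
have c1 := cont _ su; have c2 := cont _ (smooth_derive1 su).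
have c3 := cont _ sphi; have c4 := cont _ (smooth_derive1 sphi).
rewrite !Rintegral_unit_itv; [|exact: within_continuousM|exact: within_continuousM].
rewrite (@Rintegration_by_parts _ u phi u^`() phi^`())//.
- by rewrite !(test_function0 tphi) ?ltxx ?andbF// !mulr0 subrr sub0r.
- exact: smooth_LRcontinuous.
- exact: smooth_LRcontinuous.
Qed.

End SmoothWeakDerivative.

(** * Complex-valued edge functions, their traces and weak derivatives *)

Section ComplexEdge.
Context {R : realType}.
Notation mu := (@lebesgue_measure R).
Notation I := (@unit_itv R).
Local Open Scope complex_scope.

Lemma weak_deriv1_parts (u v : R -> R[i]) (phi : R -> R) :
  weak_deriv 1 u v -> test_function phi ->
  \int[mu]_(x in I) (complex.Re (u x) * phi^`() x) =
    - (\int[mu]_(x in I) (complex.Re (v x) * phi x)) /\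
  \int[mu]_(x in I) (complex.Im (u x) * phi^`() x) =
    - (\int[mu]_(x in I) (complex.Im (v x) * phi x)).
Proof. by move=> [_ uv] /uv; rewrite expr1 mulN1r => -[-> ->]. Qed.

Lemma weak_deriv2_parts (u v : R -> R[i]) (phi : R -> R) :
  weak_deriv 2 u v -> test_function phi ->
  \int[mu]_(x in I) (complex.Re (u x) * phi^`()^`() x) =
    \int[mu]_(x in I) (complex.Re (v x) * phi x) /\
  \int[mu]_(x in I) (complex.Im (u x) * phi^`()^`() x) =
    \int[mu]_(x in I) (complex.Im (v x) * phi x).
Proof. by move=> [_ uv] /uv; rewrite sqrrN expr1n mul1r => -[-> ->]. Qed.

Lemma L2_eq_Re (u v : R -> R[i]) : L2_eq u v ->
  (fun x => complex.Re (u x)) = (fun x => complex.Re (v x)) %[ae mu in I].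
Proof. by apply: ae_unit_imp => x _ ->. Qed.

Lemma L2_eq_Im (u v : R -> R[i]) : L2_eq u v ->
  (fun x => complex.Im (u x)) = (fun x => complex.Im (v x)) %[ae mu in I].
Proof. by apply: ae_unit_imp => x _ ->. Qed.

Lemma ReZ (a : R) (z : R[i]) : complex.Re (a%:C * z) = a * complex.Re z.
Proof. by case: z => x y /=; rewrite mul0r subr0. Qed.

Lemma ImZ (a : R) (z : R[i]) : complex.Im (a%:C * z) = a * complex.Im z.
Proof. by case: z => x y /=; rewrite mul0r addr0. Qed.

(** Since [s], [S] and [C] are real, [edge_solution] applies to real and imaginary parts separately.
    The equation is the Dirichlet condition at 1; the second part is uniqueness for zero Cauchy data
    at the vertex. *)
Lemma complex_edge (s : R) (S C : R -> R) (f f2 : R -> R[i]) (c d : R[i]) :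
  (forall x : R, is_derive x 1 S (C x)) ->
  (forall x : R, is_derive x 1 C (s * S x)) -> S 0 = 0 -> C 0 = 1 ->
  Sobolev 2 f -> trace_at 1 f 0 -> trace_at 0 f c -> deriv_trace_at 0 f d ->
  weak_deriv 2 f f2 -> L2_eq f2 (fun x => s%:C * f x) ->
  (C 1)%:C * c + (S 1)%:C * d = 0 /\ (c = 0 -> d = 0 -> L2_eq f (fun=> 0)).
Proof.
move=> dS dC S0 C0 [[mRe mIm _] _] [F1 [cRe1 cIm1 fF1 F10]] [F0 [cRe0 cIm0 fF0 F0c]].
move=> [v wv [G [cReG cImG vG Gd]]] wf2 f2E.
have [[mRev mImv _] _] := wv.
have [[mRef2 mImf2 _] _] := wf2.
have [eRe zRe] := @edge_solution R s S C dS dC S0 C0 _ _ _ _ _ _ mRe mRev mRef2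
  cRe0 cRe1 cReG (L2_eq_Re fF0) (L2_eq_Re fF1) (L2_eq_Re vG)
  (fun phi tphi => (weak_deriv1_parts wv tphi).1)
  (fun phi tphi => (weak_deriv2_parts wf2 tphi).1)
  (ae_unit_imp (fun x _ e => etrans (congr1 (@complex.Re R) e) (ReZ _ _)) f2E).
have [eIm zIm] := @edge_solution R s S C dS dC S0 C0 _ _ _ _ _ _ mIm mImv mImf2
  cIm0 cIm1 cImG (L2_eq_Im fF0) (L2_eq_Im fF1) (L2_eq_Im vG)
  (fun phi tphi => (weak_deriv1_parts wv tphi).2)
  (fun phi tphi => (weak_deriv2_parts wf2 tphi).2)
  (ae_unit_imp (fun x _ e => etrans (congr1 (@complex.Im R) e) (ImZ _ _)) f2E).
rewrite -F0c -Gd; split.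
  move: eRe eIm; rewrite F10 /= => eRe eIm.
  by apply/eqP; rewrite eq_complex !raddfD/= !ReZ !ImZ/= ![_ 1 * _]mulrC -eRe -eIm eqxx.
move=> c0 d0; rewrite c0 d0 in zRe zIm.
apply: ae_unit_imp2 (zRe erefl erefl) (zIm erefl erefl) => x _.
by case: (f x) => a b /= -> ->.
Qed.

Lemma L2_smooth (u : R -> R) : smooth u -> L2 (fun x => (u x)%:C).
Proof.
move=> su; have cu : {within `[0, 1], continuous u}.
  by apply: continuous_subspaceT; exact: smooth_continuous.
split => /=; [exact: measurable_continuous|exact: measurable_cst|].
apply: (@continuous_integrable R (fun x => u x ^+ 2 + 0 ^+ 2)).
have -> : (fun x => u x ^+ 2 + 0 ^+ 2) = fun x => u x * u x.
  by apply/funext => x; rewrite expr2 expr0n/= addr0.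
exact: within_continuousM.
Qed.

Lemma pairing_smooth (u phi : R -> R) :
  pairing (fun x => (u x)%:C) phi = (\int[mu]_(x in I) (u x * phi x))%:C.
Proof.
rewrite /pairing /=; congr (_ +i* _).
under eq_Rintegral do rewrite mul0r.
by rewrite Rintegral_cst ?mul0r//; exact: measurable_unit_itv.
Qed.

(** Each induction step integrates by parts once, which gives one factor -1; [u] is generalised
    because it is replaced by its derivative. *)
Lemma weak_deriv_smooth (k : nat) (u : R -> R) : smooth u ->
  weak_deriv k (fun x => (u x)%:C) (fun x => (derive1n k u x)%:C).
Proof.
move=> su; split.
  by apply: L2_smooth => i x; rewrite /derive1n -iterD; exact: su.
elim: k u su => [|k IH] u su phi tphi.
  by rewrite expr0 mul1r.
have tk : test_function (derive1n k phi).
  by elim: k {IH} => [//|k tk]; rewrite derive1nS; exact: test_function_derive1.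
rewrite derive1nS pairing_smooth smooth_weak_deriv// rmorphN/= -pairing_smooth.
by rewrite (IH _ (smooth_derive1 su))// exprS mulN1r mulNr -derive1Sn.
Qed.

Lemma Sobolev_smooth (m : nat) (u : R -> R) : smooth u ->
  Sobolev m (fun x => (u x)%:C).
Proof.
move=> su; split; first exact: L2_smooth.
by move=> k _; exists (fun x => (derive1n k u x)%:C); exact: weak_deriv_smooth.
Qed.

Lemma trace_at_smooth (a : R) (u : R -> R) : smooth u ->
  trace_at a (fun x => (u x)%:C) (u a)%:C.
Proof.
move=> su; exists (fun x => (u x)%:C); split=> //=.
- by apply: continuous_subspaceT; exact: smooth_continuous.
- by apply: continuous_subspaceT => x; exact: cvg_cst.
- by apply: aeW.
Qed.

Lemma deriv_trace_at_smooth (a : R) (u : R -> R) : smooth u ->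
  deriv_trace_at a (fun x => (u x)%:C) (u^`() a)%:C.
Proof.
move=> su; exists (fun x => (u^`() x)%:C); first exact: (@weak_deriv_smooth 1).
exact/trace_at_smooth/smooth_derive1.
Qed.

End ComplexEdge.

(** * Fundamental solutions on the two kinds of edges and the secular equation *)

Section Oscillators.
Context {R : realType}.
Implicit Types (k x : R) (p : bool).

(* The solutions of y'' = osc_s k p * y with (y, y') = (0, 1) and (1, 0) at 0;
   p tells whether the edge is a positive one. *)
Definition osc_s k p : R := if p then - k ^+ 2 else k ^+ 2.
Definition osc_S k p x : R :=
  if p then sin (k * x) / k else (expR (k * x) - expR (- (k * x))) / (2 * k).
Definition osc_C k p x : R :=
  if p then cos (k * x) else (expR (k * x) + expR (- (k * x))) / 2.

Lemma is_derive_scale (f : R -> R) (df k c x : R) :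
  is_derive (k * x) 1 f df ->
  is_derive x 1 (fun x => f (k * x) * c) (k * df * c).
Proof.
move=> dfE.
have d1 : is_derive x 1 (fun x : R => k * x) k.
  by have := @is_deriveZ _ _ _ id k x 1 1 (is_derive_id x 1); rewrite [k *: 1]mulr1.
have := is_deriveM (@is_derive1_comp _ f (fun x => k * x) x _ _ dfE d1)
  (is_derive_cst c x 1).
by rewrite scaler0 add0r /= /GRing.scale/= => H; rewrite mulrC (mulrC k).
Qed.

Lemma is_derive_expRN x : is_derive x 1 (fun x : R => expR (- x)) (- expR (- x)).
Proof.
have := @is_derive1_comp _ expR -%R x _ _ (is_derive_expR (- x)) (is_deriveNid x 1).
by rewrite mulrN1.
Qed.

Lemma is_derive_osc_S k p x : k != 0 ->
  is_derive x 1 (osc_S k p) (osc_C k p x).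
Proof.
move=> k0; rewrite /osc_S /osc_C; case: p.
  have := @is_derive_scale (@sin R) _ k k^-1 x (is_derive_sin _).
  by rewrite mulrC mulrA mulVf// mul1r.
have := @is_derive_scale (expR - (fun x => expR (- x))) _ k (2 * k)^-1 x
  (is_deriveB (is_derive_expR _) (is_derive_expRN _)).
by move=> H; apply: (@is_derive_eq _ _ _ _ _ _ _ _ H); field.
Qed.

Lemma is_derive_osc_C k p x : k != 0 ->
  is_derive x 1 (osc_C k p) (osc_s k p * osc_S k p x).
Proof.
move=> k0; rewrite /osc_S /osc_C /osc_s; case: p.
  have := @is_derive_scale (@cos R) _ k 1 x (is_derive_cos _).
  under [X in is_derive _ _ X _]eq_fun do rewrite mulr1.
  by move=> H; apply: (@is_derive_eq _ _ _ _ _ _ _ _ H); field.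
have := @is_derive_scale (expR + (fun x => expR (- x))) _ k 2^-1 x
  (is_deriveD (is_derive_expR _) (is_derive_expRN _)).
by move=> H; apply: (@is_derive_eq _ _ _ _ _ _ _ _ H); field.
Qed.

Lemma osc_S0 k p : osc_S k p 0 = 0.
Proof. by rewrite /osc_S mulr0 sin0 oppr0 subrr !mul0r; case: p. Qed.

Lemma osc_C0 k p : osc_C k p 0 = 1.
Proof. by rewrite /osc_C mulr0 cos0 oppr0 expR0; case: p => //; field. Qed.

(** The bound [k < pi] gives [sin k > 0] on positive edges, and [0 < k] gives [sinh k > 0] on
    negative ones. These are the denominators of the secular equation. *)
Lemma osc_S1_gt0 k p : 0 < k < pi -> 0 < osc_S k p 1.
Proof.
move=> /[dup] kpi /andP[k0 _]; rewrite /osc_S mulr1; case: p.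
  by rewrite divr_gt0// sin_gt0_pi.
by rewrite divr_gt0 ?mulr_gt0// subr_gt0 ltr_expR; lra.
Qed.

Lemma secular_root (np nn : nat) : (0 < np)%N -> (0 < nn)%N ->
  exists k : R, [/\ 0 < k < pi &
    np%:R * (osc_C k true 1 / osc_S k true 1) +
    nn%:R * (osc_C k false 1 / osc_S k false 1) = 0 :> R].
Proof.
move=> np0 nn0.
(* The secular function times [sin k * 2 sinh k / k]: without denominators it is continuous up to
   [pi], where [sin] vanishes. *)
pose h k : R := np%:R * cos k * (expR k - expR (- k)) + nn%:R * (expR k + expR (- k)) * sin k.
have npR : 0 < np%:R :> R by rewrite ltr0n.
have nnR : 0 < nn%:R :> R by rewrite ltr0n.
have p0 := pi_gt0 R.
have ch : continuous h.
  have cN : continuous (fun x : R => expR (- x)).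
    by move=> x; apply: continuous_comp; [exact: continuousN|exact: continuous_expR].
  move=> x; apply: cvgD; apply: cvgM.
  - by apply: cvgM; [exact: cvg_cst|exact: continuous_cos].
  - by apply: cvgB; [exact: continuous_expR|exact: cN].
  - apply: cvgM; first exact: cvg_cst.
    by apply: cvgD; [exact: continuous_expR|exact: cN].
  - exact: continuous_sin.
have h1 : 0 < h (pi / 2).
  rewrite /h cos_pihalf sin_pihalf mulr0 mul0r add0r mulr1 mulr_gt0//.
  by rewrite addr_gt0// expR_gt0.
have h2 : h pi < 0.
  rewrite /h cospi sinpi mulr0 addr0 mulrN1 mulNr oppr_lt0 mulr_gt0//.
  by rewrite subr_gt0 ltr_expR; lra.
have [|||k kI hk] := @IVT R h (pi / 2) pi 0; first by lra.
- exact: continuous_subspaceT.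
- by rewrite ge_min le_max (ltW h1) (ltW h2) !orbT.
move: kI; rewrite in_itv/= => /andP[k1 k2].
have kpi : 0 < k < pi.
  apply/andP; split; first by lra.
  (* The endpoint [pi] returned by the closed interval is excluded because [h pi < 0]. *)
  by rewrite lt_neqAle k2 andbT; apply/eqP => kE; move: h2; rewrite -kE hk ltxx.
exists k; split=> //.
have [k0 _] := andP kpi.
have s0 := sin_gt0_pi kpi.
have e0 : 0 < expR k - expR (- k) by rewrite subr_gt0 ltr_expR; lra.
rewrite /osc_C /osc_S !mulr1.
have -> : np%:R * (cos k / (sin k / k)) + nn%:R *
   ((expR k + expR (- k)) / 2 / ((expR k - expR (- k)) / (2 * k))) =
   h k * (k / (sin k * (expR k - expR (- k)))).
  by rewrite /h; field; rewrite !gt_eqF.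
by rewrite hk mul0r.
Qed.

End Oscillators.

(** * Eigenvalues [k^2] with [0 < k < pi] and roots of the secular equation *)

Section StarGraphSpectrum.
Context {R : realType} (np nn : nat).
Local Open Scope complex_scope.

Lemma sum_edges (V : nmodType) (F : bool -> V) :
  \sum_(j < np + nn) F (j < np)%N = F true *+ np + F false *+ nn.
Proof.
rewrite big_split_ord/=; congr (_ + _).
  rewrite (eq_bigr (fun=> F true)) => [|j _]; last by rewrite ltn_ord.
  by rewrite sumr_const card_ord.
rewrite (eq_bigr (fun=> F false)) => [|j _]; last by rewrite ltnNge leq_addr.
by rewrite sumr_const card_ord.
Qed.

Lemma eigenvalue_secular (k : R) : 0 < k < pi ->
  eigenvalue_B np nn (k ^+ 2)%:C ->
  np%:R * (osc_C k true 1 / osc_S k true 1) +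
  nn%:R * (osc_C k false 1 / osc_S k false 1) = 0 :> R.
Proof.
move=> kpi [f [fn0 [[Sf tf1 [c tf0] [d df sumd]] [f2 wf2 gf]]]].
have k0 : k != 0 by case/andP: kpi => /gt_eqF ->.
have edge (j : 'I_(np + nn)) := complex_edge
  (fun x => is_derive_osc_S (j < np)%N x k0)
  (fun x => is_derive_osc_C (j < np)%N x k0)
  (osc_S0 k (j < np)%N) (osc_C0 k (j < np)%N)
  (Sf j) (tf1 j) (tf0 j) (df j) (wf2 j).
(* The sign in the action of [B] turns the eigenvalue [k^2] into [-k^2] on positive edges, which is
   [osc_s]. *)
have f2E j : L2_eq (f2 j) (fun x => (osc_s k (j < np)%N)%:C * f j x).
  apply: ae_unit_imp (gf j) => x _; rewrite /osc_s; case: ifP => _ e.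
    by rewrite rmorphN mulNr e opprK.
  by rewrite e.
have S1 p : osc_S k p 1 != 0 by rewrite gt_eqF// osc_S1_gt0.
pose q p := osc_C k p 1 / osc_S k p 1.
have dE j : d j = - c * (q (j < np)%N)%:C.
  have [e _] := edge j (f2E j).
  have S1C : (osc_S k (j < np)%N 1)%:C != 0 by rewrite fmorph_eq0.
  apply: (mulfI S1C); move/eqP: e; rewrite addrC addr_eq0 => /eqP ->.
  by rewrite /q rmorphM fmorphV; field.
(* If [c = 0], every [d j] vanishes too, so all Cauchy data at the vertex are zero and [f] is zero
   on each edge. *)
have c0 : c != 0.
  apply/eqP => c0; apply: fn0 => j; have [_ H] := edge j (f2E j).
  by apply: H => //; rewrite dE c0 oppr0 mul0r.
move: sumd; under eq_bigr do rewrite dE.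
rewrite -mulr_sumr => /eqP; rewrite mulf_eq0 oppr_eq0 (negbTE c0)/= => /eqP.
rewrite (sum_edges (fun p => (q p)%:C)) -!rmorphMn -rmorphD => /eqP.
by rewrite fmorph_eq0 -(mulr_natl (q true)) -(mulr_natl (q false)) => /eqP.
Qed.

(** The function [S(1 - x) / S(1)] on each edge is an eigenfunction: it is 1 at the vertex and 0 at
    the outer end, and its derivative at the vertex is [- C(1) / S(1)], so that the Kirchhoff
    condition is the secular equation. *)
Lemma secular_eigenvalue (k : R) : (0 < np)%N -> 0 < k < pi ->
  np%:R * (osc_C k true 1 / osc_S k true 1) +
  nn%:R * (osc_C k false 1 / osc_S k false 1) = 0 :> R ->
  eigenvalue_B np nn (k ^+ 2)%:C.
Proof.
move=> np0 kpi sec.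
have k0 : k != 0 by case/andP: kpi => /gt_eqF ->.
have S1 p : osc_S k p 1 != 0 by rewrite gt_eqF// osc_S1_gt0.
have dS p (x : R) := is_derive_osc_S p x k0.
have dC p (x : R) := is_derive_osc_C p x k0.
pose u p (x : R) := (osc_S k p 1)^-1 * osc_S k p (1 - x).
have su p : smooth (u p).
  have [sS _] := smooth_reflect (dS p) (dC p) 1.
  by apply: smoothM; [exact: smooth_cst|exact: sS].
have du p : (u p)^`() = fun x => - (osc_S k p 1)^-1 * osc_C k p (1 - x).
  apply: is_derive1_eq => x.
  apply: (@is_derive_eq _ _ _ _ _ _ _ _
    (is_deriveZ (osc_S k p 1)^-1 (is_derive_reflect 1 (dS p) x))).
  by rewrite mulNr -mulrN.
have ddu p : (u p)^`()^`() = fun x => osc_s k p * u p x.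
  rewrite du; apply: is_derive1_eq => x.
  apply: (@is_derive_eq _ _ _ _ _ _ _ _
    (is_deriveZ (- (osc_S k p 1)^-1) (is_derive_reflect 1 (dC p) x))).
  by rewrite /u /GRing.scale/= mulrNN mulrCA.
have u0 p : u p 0 = 1 by rewrite /u subr0 mulVf.
exists (fun j x => (u (j < np)%N x)%:C); split.
  (* One edge suffices to see that the function is nonzero: it is continuous with value 1 at the
     vertex. *)
  have j0 : 'I_(np + nn) by exists 0%N; rewrite addn_gt0 np0.
  move=> /(_ j0)/L2_eq_Re /= H.
  have cu : {within `[0, 1], continuous (u (j0 < np)%N)}.
    by apply: continuous_subspaceT; exact: smooth_continuous.
  have c0 : {within `[0, 1], continuous (fun _ : R => 0 : R)}.
    by apply: continuous_subspaceT => x; exact: cvg_cst.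
  have := ae_eq_continuous cu c0 H; move=> /(_ 0); rewrite u0 lexx ler01 => /(_ isT).
  by move/eqP; rewrite oner_eq0.
split; first split.
- by move=> j; exact: Sobolev_smooth.
- move=> j; have := trace_at_smooth 1 (su (j < np)%N).
  by rewrite {2}/u subrr osc_S0 mulr0.
- exists 1 => j; have := trace_at_smooth 0 (su (j < np)%N).
  by rewrite u0.
- exists (fun j => ((u (j < np)%N)^`() 0)%:C).
    by move=> j; exact: deriv_trace_at_smooth.
  rewrite (sum_edges (fun p => ((u p)^`() 0)%:C)) -!rmorphMn -rmorphD/= !du !subr0.
  have -> : - (osc_S k true 1)^-1 * osc_C k true 1 = - (osc_C k true 1 / osc_S k true 1).
    by rewrite mulNr mulrC.
  have -> : - (osc_S k false 1)^-1 * osc_C k false 1 = - (osc_C k false 1 / osc_S k false 1).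
    by rewrite mulNr mulrC.
  rewrite !mulNrn -opprD -(mulr_natl (osc_C k true 1 / _)).
  rewrite -(mulr_natl (osc_C k false 1 / _)).
  by rewrite sec oppr0.
exists (fun j x => ((u (j < np)%N)^`()^`() x)%:C).
  by move=> j; exact: (@weak_deriv_smooth _ 2).
move=> j; apply: aeW => x _; rewrite ddu /osc_s; case: (j < np)%N.
  by rewrite -rmorphM -rmorphN/= mulNr opprK.
by rewrite -rmorphM.
Qed.

End StarGraphSpectrum.

(** * From the secular equation at the first positive eigenvalue to the ratio *)

Theorem corollary4p2 (R : realType) (np nn : nat)
    (hp : (1 <= np)%N) (hn : (1 <= nn)%N) (eta1 : R)
    (heta1 : first_positive_eigenvalue_B np nn eta1) :
  np%:R / nn%:R = - coth (Num.sqrt eta1) * tan (Num.sqrt eta1) :> R.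
Proof.
have [eta0 ev least] := heta1.
have [k0 [k0pi sec0]] := @secular_root R np nn hp hn.
have [k0_gt0 k0_ltpi] := andP k0pi.
(* Minimality of [eta1] against the eigenvalue [k0^2] is what places [sqrt eta1] below [pi]. *)
have eta_le : eta1 <= k0 ^+ 2.
  apply: least; first by rewrite exprn_gt0.
  exact: secular_eigenvalue hp k0pi sec0.
set k := Num.sqrt eta1.
have k_gt0 : 0 < k by rewrite sqrtr_gt0.
have kpi : 0 < k < pi.
  rewrite k_gt0/= (le_lt_trans _ k0_ltpi)//.
  by rewrite -(ger0_norm (ltW k0_gt0)) -sqrtr_sqr ler_wsqrtr.
have evk : eigenvalue_B np nn (k ^+ 2)%:C%C by rewrite sqr_sqrtr ?ltW.
have := eigenvalue_secular kpi evk; rewrite /osc_C /osc_S !mulr1 => sec.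
have sk : sin k != 0 by rewrite gt_eqF// sin_gt0_pi.
have nn0 : nn%:R != 0 :> R by rewrite pnatr_eq0 -lt0n.
have Em : 0 < expR k - expR (- k) by rewrite subr_gt0 ltr_expR; lra.
have Ep : 0 < expR k + expR (- k) by rewrite addr_gt0 ?expR_gt0.
have Em0 : expR k - expR (- k) != 0 by rewrite gt_eqF.
have kn0 : k != 0 by rewrite gt_eqF.
(* Clearing denominators leaves a form that can be evaluated at [cos k = 0]. *)
have sec' : np%:R * cos k * (expR k - expR (- k)) +
    nn%:R * (expR k + expR (- k)) * sin k = 0.
  have -> : np%:R * cos k * (expR k - expR (- k)) +
      nn%:R * (expR k + expR (- k)) * sin k =
      (np%:R * (cos k / (sin k / k)) + nn%:R * ((expR k + expR (- k)) / 2 /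
        ((expR k - expR (- k)) / (2 * k)))) * (sin k * (expR k - expR (- k)) / k).
    by field; rewrite sk Em0 kn0.
  by rewrite sec mul0r.
(* With [cos k = 0] only a product of nonzero factors would remain in [sec']. Hence [tan k] is a
   true quotient and not the default value of a division by 0. *)
have ck : cos k != 0.
  apply/eqP => ck0; move/eqP: sec'; rewrite ck0 mulr0 mul0r add0r.
  by rewrite !mulf_eq0 (negbTE nn0) (negbTE sk) (gt_eqF Ep).
rewrite /coth /tan; apply/eqP; rewrite -subr_eq0; apply/eqP.
have -> : np%:R / nn%:R -
    - ((expR k + expR (- k)) / (expR k - expR (- k))) * (sin k / cos k) =
   (np%:R * cos k * (expR k - expR (- k)) + nn%:R * (expR k + expR (- k)) * sin k) /
   (nn%:R * cos k * (expR k - expR (- k))).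
  by field; rewrite nn0 ck Em0.
by rewrite sec' mul0r.
Qed.
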